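(* Let $C_{(\geq,>)}(x,y)$ be the bivariate generating function of the Catalan words avoiding the ordered pair of relations $(\geq,>)$, where $x$ marks the length and $y$ marks the number of descents. Then $$C_{(\geq,>)}(x,y)=\frac{1 - 2 x + x^2 y - \sqrt{1 - 4 x + 4 x^2 - 2 x^2 y + x^4 y^2}}{2 x^2 y}.$$
   Context: A Catalan word of length $n$ is a word $w=w_1w_2\cdots w_n$ over the non-negative integers with $w_1=0$ and $0\leq w_i\leq w_{i-1}+1$ for $i=2,\dots,n$; the empty word is the unique Catalan word of length $0$. For relations $X,Y\in\{<,>,\leq,\geq,=,\neq\}$, a word $w$ contains the pattern $(X,Y)$ if there is an index $i\geq 1$ (with $i+2\le n$) such that $w_i\,X\,w_{i+1}$ and $w_{i+1}\,Y\,w_{i+2}$; otherwise $w$ avoids $(X,Y)$. The number of descents $\mathrm{des}(w)$ is the number of indices $i$ with $w_i>w_{i+1}$. The bivariate generating function is $C_{(X,Y)}(x,y)=\sum_{w}x^{|w|}y^{\mathrm{des}(w)}$, the sum being over all Catalan words $w$ (of any length $|w|\geq 0$) avoiding $(X,Y)$. Identities are between formal power series in $x$ with coefficients polynomials in $y$ (after clearing denominators); the square root of a power series with constant term $1$ is the one with constant term $1$. *)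

(* Defs.v *)
From HB Require Import structures.
From mathcomp Require Import all_boot all_order all_algebra.
From mathcomp Require Import boolp classical_sets.

Set Implicit Arguments.
Unset Strict Implicit.
Unset Printing Implicit Defensive.

Import Order.TTheory GRing.Theory Num.Theory.

Local Open Scope ring_scope.

Record fps (R : Type) := Fps { fps_coef : nat -> R }.

(* The equality test and the choice operator on power series are classical. *)
HB.instance Definition _ (R : Type) := gen_eqMixin (fps R).
HB.instance Definition _ (R : Type) := gen_choiceMixin (fps R).

Lemma fpsP (R : Type) (f g : fps R) :
  (forall n, fps_coef f n = fps_coef g n) <-> f = g.
Proof.
split=> [|-> //]; case: f g => [f] [g] /= fg.
by congr Fps; apply: funext.
Qed.

Section FpsRing.
Variable R : comNzRingType.
Implicit Types f g h : fps R.

Definition fps_add f g := Fps (fun n => fps_coef f n + fps_coef g n).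
Definition fps_opp f := Fps (fun n => - fps_coef f n).
Definition fps_mul f g :=
  Fps (fun n => \sum_(i < n.+1) fps_coef f i * fps_coef g (n - i)).
Definition fpsC (c : R) := Fps (fun n => if n == 0%N then c else 0).
Definition fpsX : fps R := Fps (fun n => (n == 1%N)%:R).

Fact fps_addA : associative fps_add.
Proof. by move=> f g h; apply/fpsP => n /=; rewrite addrA. Qed.

Fact fps_addC : commutative fps_add.
Proof. by move=> f g; apply/fpsP => n /=; rewrite addrC. Qed.

Fact fps_add0 : left_id (fpsC 0) fps_add.
Proof. by move=> f; apply/fpsP => n /=; rewrite if_same add0r. Qed.

Fact fps_addN : left_inverse (fpsC 0) fps_opp fps_add.
Proof. by move=> f; apply/fpsP => n /=; rewrite if_same addNr. Qed.

HB.instance Definition _ :=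
  GRing.isZmodule.Build (fps R) fps_addA fps_addC fps_add0 fps_addN.

Let trunc n f : {poly R} := \poly_(i < n.+1) fps_coef f i.

Let coef_trunc n f i : (i <= n)%N -> (trunc n f)`_i = fps_coef f i.
Proof. by move=> lein; rewrite coef_poly ltnS lein. Qed.

Let mul_trunc n f g i : (i <= n)%N ->
  fps_coef (fps_mul f g) i = (trunc n f * trunc n g)`_i.
Proof.
move=> lein; rewrite coefM /=; apply: eq_bigr => j _.
have leji := leq_ord j.
by rewrite !coef_trunc ?(leq_trans _ lein) ?leq_subr.
Qed.

Fact fps_mulC : commutative fps_mul.
Proof.
by move=> f g; apply/fpsP => n; rewrite !(@mul_trunc n) // mulrC.
Qed.

Fact fps_mulA : associative fps_mul.
Proof.
move=> f g h; apply/fpsP => n.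
transitivity ((trunc n f * (trunc n g * trunc n h))`_n).
  rewrite coefM /=; apply: eq_bigr => i _; have lein := leq_ord i.
  by rewrite coef_trunc // -mul_trunc // leq_subr.
rewrite mulrA coefM /=; apply: eq_bigr => i _; have lein := leq_ord i.
by rewrite coef_trunc ?leq_subr // -mul_trunc.
Qed.

Fact fps_mul1 : left_id (fpsC 1) fps_mul.
Proof.
move=> f; apply/fpsP => n /=.
rewrite big_ord_recl /= mul1r subn0 big1 ?addr0 // => i _.
by rewrite mul0r.
Qed.

Fact fps_mulDl : left_distributive fps_mul fps_add.
Proof.
move=> f g h; apply/fpsP => n /=.
by rewrite -big_split /=; apply: eq_bigr => i _; rewrite mulrDl.
Qed.

Fact fps_oner_neq0 : fpsC 1 != 0.
Proof.
apply/eqP => /(congr1 (fun f => fps_coef f 0)) /= /eqP.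
by rewrite oner_eq0.
Qed.

HB.instance Definition _ := GRing.Zmodule_isComNzRing.Build (fps R)
  fps_mulA fps_mulC fps_mul1 fps_mulDl fps_oner_neq0.

Lemma fps_coefD f g n : fps_coef (f + g) n = fps_coef f n + fps_coef g n.
Proof. by []. Qed.

Lemma fps_coefN f n : fps_coef (- f) n = - fps_coef f n.
Proof. by []. Qed.

Lemma fps_coefM f g n :
  fps_coef (f * g) n = \sum_(i < n.+1) fps_coef f i * fps_coef g (n - i).
Proof. by []. Qed.

Lemma fps_coef0 n : fps_coef (0 : fps R) n = 0.
Proof. by rewrite /= if_same. Qed.

Lemma fps_coef1 n : fps_coef (1 : fps R) n = (n == 0%N)%:R.
Proof. by case: n. Qed.

Lemma fps_coef_sqrS f n : fps_coef (f ^+ 2) n.+1 =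
  2%:R * (fps_coef f 0 * fps_coef f n.+1) +
  \sum_(i < n) fps_coef f i.+1 * fps_coef f (n - i).
Proof.
rewrite expr2 fps_coefM big_ord_recl big_ord_recr subn0 /= /bump /= add1n subnn.
rewrite [_ * fps_coef f 0]mulrC [\sum_(i < n) _ + _]addrC addrA -mulr2n.
rewrite mulr_natl; congr (_ + _).
Qed.

End FpsRing.

(* Junk value 0 when no square root with constant term 1 exists; see
   [fps_sqrtP] and [fps_sqrt_unique]. *)
Definition fps_sqrt (R : comNzRingType) (f : fps R) : fps R :=
  xget 0 [set g : fps R | fps_coef g 0 = 1 /\ g ^+ 2 = f]%classic.

Section FpsSqrt.
Variable R : comUnitRingType.
Hypothesis unit2 : (2%:R : R) \is a GRing.unit.
Variable f : fps R.
Hypothesis f0 : fps_coef f 0 = 1.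

Let sqrt_step (s : seq R) n : R :=
  2%:R^-1 * (fps_coef f n.+1 - \sum_(i < n) s`_i.+1 * s`_(n - i)).

Let sqrt_seq := fix F n : seq R :=
  if n is m.+1 then rcons (F m) (sqrt_step (F m) m) else [:: 1].

Let size_sqrt_seq n : size (sqrt_seq n) = n.+1.
Proof. by elim: n => //= n IHn; rewrite size_rcons IHn. Qed.

Let nth_sqrt_seq n i : (i <= n)%N -> (sqrt_seq n)`_i = (sqrt_seq i)`_i.
Proof.
elim: n => [|n IHn]; first by rewrite leqn0 => /eqP ->.
rewrite leq_eqVlt => /predU1P[-> //|]; rewrite ltnS => lein.
by rewrite [sqrt_seq n.+1]/= nth_rcons size_sqrt_seq ltnS lein IHn.
Qed.

Let fps_sqrt_exists : exists g : fps R, fps_coef g 0 = 1 /\ g ^+ 2 = f.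
Proof.
pose g : fps R := Fps (fun n => (sqrt_seq n)`_n).
exists g; split=> //; apply/fpsP => -[|n].
  by rewrite expr2 fps_coefM big_ord1 /= mulr1 f0.
rewrite fps_coef_sqrS.
have -> : fps_coef g 0 = 1 by [].
have -> : fps_coef g n.+1 = sqrt_step (sqrt_seq n) n.
  by rewrite /= nth_rcons size_sqrt_seq ltnn eqxx.
rewrite mul1r /sqrt_step mulrA divrr // mul1r.
set S := \sum_(i < n) _; set T := \sum_(i < n) _.
suff -> : S = T by rewrite addrC addrCA subrr addr0.
apply: eq_bigr => i _ /=.
by rewrite -(nth_sqrt_seq (ltn_ord i)) -(nth_sqrt_seq (leq_subr i n)).
Qed.

Lemma fps_sqrtP : fps_coef (fps_sqrt f) 0 = 1 /\ fps_sqrt f ^+ 2 = f.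
Proof. exact: xgetPex fps_sqrt_exists. Qed.

Lemma fps_sqrt_unique (g : fps R) :
  fps_coef g 0 = 1 -> g ^+ 2 = f -> g = fps_sqrt f.
Proof.
have [] := fps_sqrtP; move: (fps_sqrt f) => h h0 hf g0 gf.
apply/fpsP; elim/ltn_ind => -[_|n IHn]; first by rewrite g0 h0.
have : fps_coef (g ^+ 2) n.+1 = fps_coef (h ^+ 2) n.+1 by rewrite gf hf.
rewrite !fps_coef_sqrS g0 h0 !mul1r.
set S := \sum_(i < n) _; set T := \sum_(i < n) _.
suff -> : S = T by move=> /addIr /(mulrI unit2).
apply: eq_bigr => i _.
by rewrite !IHn ?ltnS ?leq_subr //.
Qed.

End FpsSqrt.

Fact polyrat_unit2 : (2%:R : {poly rat}) \is a GRing.unit.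
Proof. by rewrite -polyC_natr poly_unitE coefC size_polyC. Qed.

(* Words are indexed from 0: the i-th letter [w_i] is [nth 0 w i.-1]. *)
Definition catalan (w : seq nat) : bool :=
  (nth 0 w 0 == 0)%N &&
  [forall i : 'I_(size w).-1, (nth 0 w i.+1 <= (nth 0 w i).+1)%N].

Definition contains_pair (X Y : rel nat) (w : seq nat) : bool :=
  [exists i : 'I_(size w - 2),
     X (nth 0 w i) (nth 0 w i.+1) && Y (nth 0 w i.+1) (nth 0 w i.+2)]%N.

Definition avoids_pair (X Y : rel nat) (w : seq nat) : bool :=
  ~~ contains_pair X Y w.

Definition des (w : seq nat) : nat :=
  #|[set i : 'I_(size w).-1 | (nth 0 w i > nth 0 w i.+1)%N]|.

Lemma catalan_nth_le (w : seq nat) (i : nat) :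
  catalan w -> (i < size w)%N -> (nth 0 w i <= i)%N.
Proof.
case/andP=> /eqP w0 /forallP wS; elim: i => [|i IHi] ltiw; first by rewrite w0.
have lti : (i < (size w).-1)%N by case: (size w) ltiw.
by apply: leq_trans (wS (Ordinal lti)) _; rewrite ltnS IHi // ltnW.
Qed.

(* The letters of a Catalan word of length n are smaller than n, so the
   Catalan words of length n are among the n-tuples over 'I_n. *)
Lemma catalan_tuple (n : nat) (w : seq nat) : catalan w -> size w = n ->
  exists t : n.-tuple 'I_n, map val t = w.
Proof.
move=> cw sw.
have lt_w (i : 'I_n) : (nth 0 w i < n)%N.
  by apply: leq_ltn_trans (ltn_ord i); rewrite catalan_nth_le ?sw.
exists (mktuple (fun i => Ordinal (lt_w i))).
apply: (@eq_from_nth _ 0%N) => [|i]; rewrite size_map size_tuple ?sw // => ltin.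
rewrite (nth_map (Ordinal ltin)) ?size_tuple //.
by rewrite -(tnth_nth _ _ (Ordinal ltin)) tnth_mktuple.
Qed.

(* The index of the series marks the length, the variable of its polynomial
   coefficients marks the number of descents. *)
Definition catalan_gf (X Y : rel nat) : fps {poly rat} :=
  Fps (fun n => \sum_(t : n.-tuple 'I_n |
                       catalan (map val t) && avoids_pair X Y (map val t))
                  'X ^+ des (map val t)).

(* Main.v *)
(** A nonempty Catalan word factors uniquely as [0 (u+1) v] with [u] and [v]
    Catalan. When [u] and [v] are nonempty there is a descent between them, and
    the word avoids (>=,>) iff [u] and [v] do and [u] does not end with a weak
    descent. Such words [u] are obtained in exactly one way from an arbitrary
    avoiding word by appending the largest letter allowed, so they are counted
    by [x F]. Hence [F = 1 + x F + (F - 1) (x + x^2 y F)], which says that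
    [1 - 2 x + x^2 y - 2 x^2 y F] squares to the given discriminant. *)
Require Import Defs.
From mathcomp Require Import all_boot all_order all_algebra.
From mathcomp Require Import zify ring.

Import GRing.Theory.
Local Open Scope ring_scope.

(** * Factorization of Catalan words at the second 0 *)

Definition cat_step : rel nat := fun a b => (b <= a.+1)%N.

Lemma catalanE w : catalan w = (nth 0 w 0 == 0)%N && sorted cat_step w.
Proof.
rewrite /catalan; congr (_ && _); apply/forallP/(sortedP 0%N) => [H i ltiw|H i].
  have lti : (i < (size w).-1)%N by lia.
  exact: H (Ordinal lti).
by apply: H; case: i => i /=; lia.
Qed.

Lemma catalan_nil : catalan [::].
Proof. by rewrite catalanE. Qed.

Lemma catalan_cons a s : catalan (a :: s) = (a == 0)%N && path cat_step a s.
Proof. by rewrite catalanE. Qed.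

Lemma catalan_rcons a s c :
  catalan (rcons (a :: s) c) = catalan (a :: s) && (c <= (last a s).+1)%N.
Proof. by rewrite rcons_cons !catalan_cons rcons_path andbA. Qed.

Lemma path_cat_stepS a s :
  path cat_step a.+1 (map S s) = path cat_step a s.
Proof. by rewrite path_map. Qed.

Definition graft (u v : seq nat) : seq nat := 0%N :: map S u ++ v.

Lemma size_graft u v : size (graft u v) = (size u + size v).+1.
Proof. by rewrite /= size_cat size_map. Qed.

Lemma catalan_graft u v : catalan u -> catalan v -> catalan (graft u v).
Proof.
rewrite catalan_cons /= cat_path => cu cv; apply/andP; split.
  by case: u cu => //= a u; rewrite catalan_cons path_cat_stepS => /andP[/eqP->].
by case: v cv => //= a v; rewrite catalan_cons => /andP[/eqP->].
Qed.

(** The letters of [map S u] are positive, while [v] is empty or starts with 0, so the second 0 of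
    the word marks the border. *)
Lemma graft_inj u v u' v' : catalan v -> catalan v' ->
  graft u v = graft u' v' -> u = u' /\ v = v'.
Proof.
rewrite !catalanE => /andP[/eqP v0 _] /andP[/eqP v'0 _] [].
elim: u u' => [|a u IHu] [|a' u'] //=.
- by move=> Ev; rewrite Ev in v0.
- by move=> Ev; rewrite -Ev in v'0.
- by case=> -> /IHu[-> ->].
Qed.

Lemma catalan_graftP w : catalan w -> (0 < size w)%N ->
  exists u v, [/\ catalan u, catalan v & w = graft u v].
Proof.
case: w => // a s; rewrite catalan_cons => /andP[/eqP-> ps] _.
(* The cut is made at the first 0 of [t]; the letter [b] is arbitrary because it changes along the
   induction. *)
have split_path b t : path cat_step b t -> exists u v,
    [/\ path cat_step b (map S u), catalan v & t = map S u ++ v].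
  elim: t b => [|[|c] t IHt] b /=.
  - by move=> _; exists [::], [::]; rewrite catalan_nil.
  - by move=> pt; exists [::], (0%N :: t); rewrite catalan_cons.
  - case/andP=> bc /IHt[u [v [pu cv ->]]]; exists (c :: u), v.
    by rewrite /= bc.
have [u [v [pu cv ->]]] := split_path _ _ ps.
exists u, v; split=> //; case: u pu => [|b u]; first by rewrite catalan_nil.
rewrite catalan_cons /= path_cat_stepS => /andP[]; rewrite /cat_step ltnS.
by rewrite leqn0 => ->.
Qed.

Definition catalan_words (n : nat) : seq (seq nat) :=
  [seq map val t | t : n.-tuple 'I_n <- index_enum {: n.-tuple 'I_n}
                 & catalan (map val t)].

Lemma mem_catalan_words n w :
  (w \in catalan_words n) = catalan w && (size w == n).
Proof.
apply/mapP/andP => [[t]|[cw /eqP sw]].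
  by rewrite mem_filter => /andP[ct _] ->; rewrite size_map size_tuple.
have [t tw] := catalan_tuple cw sw.
by exists t => //; rewrite mem_filter tw cw mem_index_enum.
Qed.

Lemma catalan_words_uniq n : uniq (catalan_words n).
Proof.
rewrite map_inj_uniq ?filter_uniq ?index_enum_uniq // => t t' E.
exact/val_inj/(inj_map val_inj).
Qed.

Lemma catalan_words0 : catalan_words 0 = [:: [::]].
Proof.
apply: perm_small_eq => //; apply: uniq_perm (catalan_words_uniq 0) _ _ => // w.
by rewrite mem_catalan_words inE; case: w => [|a w]; rewrite ?andbF ?catalanE.
Qed.

Lemma mem_pairs (T : eqType) (s t : seq T) (u v : T) :
  ((u, v) \in [seq (a, b) | a <- s, b <- t]) = (u \in s) && (v \in t).
Proof.
apply/allpairsP/andP => [[[a b] [sa tb [-> ->]]] //|[su tv]].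
by exists (u, v).
Qed.

Lemma catalan_wordsS n : perm_eq (catalan_words n.+1)
  [seq graft p.1 p.2 | k <- iota 0 n.+1,
     p <- [seq (u, v) | u <- catalan_words k, v <- catalan_words (n - k)]].
Proof.
apply: uniq_perm; first exact: catalan_words_uniq.
  apply: allpairs_uniq_dep; first exact: iota_uniq.
    move=> k _; apply: allpairs_uniq; rewrite ?catalan_words_uniq //.
    by case=> u v [u' v'].
  (* Since [k] is the length of [u], injectivity of [graft] also forces equal values of [k]. *)
  move=> p p' /allpairsPdep[k [[u v] [_ + ->]]] /allpairsPdep[k' [[u' v']]].
  rewrite !mem_pairs !mem_catalan_words => /andP[/andP[_ /eqP su] /andP[cv _]].
  move=> [_ /andP[/andP[_ /eqP su'] /andP[cv' _]] ->] /=.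
  by move=> /(graft_inj _ _ _ _ cv cv')[uu' vv']; rewrite -su -su' uu' vv'.
move=> w; rewrite mem_catalan_words.
apply/andP/allpairsPdep => [[cw /eqP sw]|[k [[u v] []]]].
  have [|u [v [cu cv Ew]]] := catalan_graftP _ cw; first by rewrite sw.
  move: sw; rewrite Ew size_graft => -[sw].
  exists (size u), (u, v); rewrite mem_pairs mem_iota !mem_catalan_words cu cv.
  by rewrite eqxx /=; split=> //; lia.
rewrite mem_pairs mem_iota !mem_catalan_words => kn.
case/andP=> /andP[cu /eqP su] /andP[cv /eqP sv] ->.
by rewrite catalan_graft // size_graft su sv; split=> //; lia.
Qed.

(** * Weights computed letter by letter, and their behaviour under [graft] *)

Definition weight (w : seq nat) : {poly rat} :=
  if avoids_pair geq gtn w then 'X ^+ des w else 0.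

Lemma des_nil : des [::] = 0%N.
Proof. by rewrite /des; apply: eq_card0 => -[]. Qed.

Lemma des_seq1 a : des [:: a] = 0%N.
Proof. by rewrite /des; apply: eq_card0 => -[]. Qed.

Lemma des_cons2 a b s : des [:: a, b & s] = ((b < a) + des (b :: s))%N.
Proof.
rewrite /des -!sum1dep_card !(big_mkcond (fun i => _ < _)%N) /=.
by rewrite big_ord_recl /=; case: ifP.
Qed.

Lemma avoids_small X Y w : (size w <= 2)%N -> avoids_pair X Y w.
Proof. by move=> sw; apply/existsPn => -[i]; rewrite (eqP sw : _ = 0%N). Qed.

Lemma avoids_cons3 (X Y : rel nat) a b c s :
  avoids_pair X Y [:: a, b, c & s] =
  ~~ (X a b && Y b c) && avoids_pair X Y [:: b, c & s].
Proof.
rewrite /avoids_pair /contains_pair -negb_or; congr (~~ _).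
rewrite /= !subn2 /=; apply/existsP/orP => [[[[|i] lti] /= H]|].
- by left.
- by right; apply/existsP; exists (Ordinal (lti : (i < size s)%N)).
- case=> [H|/existsP[[i lti] H]]; first by exists ord0.
  by exists (Ordinal (lti : (i.+1 < (size s).+1)%N)).
Qed.

(* Reads the word [s] after the letter [a]; [f] records whether [a] was reached
   by a weak descent. *)
Fixpoint run (f : bool) (a : nat) (s : seq nat) : {poly rat} :=
  if s is b :: s' then
    (if f && (b < a)%N then 0 else 'X ^+ (b < a)%N) * run (b <= a)%N b s'
  else 1.

(** The flag with which [run] leaves [s], needed to go on reading after [s]. *)
Fixpoint final_flag (f : bool) (a : nat) (s : seq nat) : bool :=
  if s is b :: s' then final_flag (b <= a)%N b s' else f.

(** A factor 0 appears in [run] exactly when a letter reached by a weak descent is followed by a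
    smaller one, that is, at an occurrence of the pattern. *)
Lemma weight_cons2 a b s :
  weight [:: a, b & s] = 'X ^+ (b < a)%N * run (b <= a)%N b s.
Proof.
elim: s a b => [|c s IHs] a b.
  by rewrite /weight avoids_small // des_cons2 des_seq1 addn0 mulr1.
rewrite /weight avoids_cons3 des_cons2 exprD /=.
have := IHs b c; rewrite /weight; case: ((b <= a)%N && _) => /= [_|<-]; first by rewrite mul0r mulr0.
by case: ifP; rewrite ?mulr0.
Qed.

Lemma weight_nil : weight [::] = 1.
Proof. by rewrite /weight avoids_small // des_nil. Qed.

Lemma weight_cons a s : weight (a :: s) = run false a s.
Proof.
case: s => [|b s]; last by rewrite weight_cons2.
by rewrite /weight avoids_small // des_seq1.
Qed.

Lemma run_cat f a s t :
  run f a (s ++ t) = run f a s * run (final_flag f a s) (last a s) t.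
Proof. by elim: s f a => [|b s IHs] f a /=; rewrite ?mul1r // IHs mulrA. Qed.

Lemma runS f a s : run f a.+1 (map S s) = run f a s.
Proof. by elim: s f a => //= b s IHs f a; rewrite IHs. Qed.

Lemma final_flagS f a s : final_flag f a.+1 (map S s) = final_flag f a s.
Proof. by elim: s f a => //= b s IHs f a; rewrite IHs. Qed.

Lemma final_flag_rcons f a s c : final_flag f a (rcons s c) = (c <= last a s)%N.
Proof. by elim: s f a => //= b s IHs f a. Qed.

Lemma run0 f s : run f 0 s = run false 0 s.
Proof. by case: s => //= b s; rewrite andbF. Qed.

(** The flag starts at [false], so a one-letter word counts as ascending; [extend_words] needs this
    at [n = 0]. *)
Definition ends_ascending (w : seq nat) : bool :=
  if w is a :: s then ~~ final_flag false a s else false.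

(** A nonempty [v] starts with 0, so the new 0 opens a weak descent; it completes no pattern because
    no letter lies below 0. *)
Lemma weight_graft0 v : catalan v -> weight (graft [::] v) = weight v.
Proof.
case: v => [|a v]; first by rewrite weight_cons weight_nil.
by rewrite catalan_cons => /andP[/eqP-> _]; rewrite !weight_cons /= mul1r run0.
Qed.

Lemma weight_graft_nil u : catalan u -> weight (graft u [::]) = weight u.
Proof.
rewrite /graft cats0.
case: u => [|a u]; first by rewrite weight_cons weight_nil.
by rewrite catalan_cons => /andP[/eqP-> _]; rewrite !weight_cons /= mul1r runS.
Qed.

(** The junction goes from a positive letter down to 0. This descent gives the factor ['X], and
    completes a pattern exactly when [u] ends with a weak descent. *)
Lemma weight_graft u v :
  catalan u -> catalan v -> (0 < size u)%N -> (0 < size v)%N ->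
  weight (graft u v) =
  'X * ((if ends_ascending u then weight u else 0) * weight v).
Proof.
case: u v => [|a u] [|b v] //; rewrite !catalan_cons.
case/andP=> /eqP-> _ /andP[/eqP-> _] _ _.
rewrite !weight_cons /= run_cat runS final_flagS last_map mul1r /= andbT.
(* The first 0 of [v] is reached by a descent, but nothing is below 0, so the rest of [v] is read as
   if [v] stood alone. *)
rewrite (run0 (0 <= _)%N).
by case: final_flag; rewrite /= ?mul0r ?mulr0 ?mulr0 // expr1 mulrCA.
Qed.

(** * Appending the largest letter allowed *)

Definition extend (w : seq nat) : seq nat :=
  rcons w (if w is a :: s then (last a s).+1 else 0%N).

(** The pattern ends with a strict descent, so a final ascent neither completes one nor adds a
    descent. *)
Lemma weight_extend w : weight (extend w) = weight w.
Proof.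
case: w => [|a s]; first by rewrite weight_cons weight_nil.
rewrite /extend rcons_cons !weight_cons -cats1 run_cat /=.
by rewrite ltnNge leqnSn andbF !mulr1.
Qed.

(** A final letter above its predecessor exceeds it by exactly 1 in a Catalan word, so it is
    determined by the rest. *)
Lemma extend_words n :
  perm_eq [seq w <- catalan_words n.+1 | ends_ascending w]
          (map extend (catalan_words n)).
Proof.
apply: uniq_perm; first by rewrite filter_uniq ?catalan_words_uniq.
  by rewrite map_inj_uniq ?catalan_words_uniq // => w w' /rcons_inj[].
move=> w; rewrite mem_filter mem_catalan_words.
apply/and3P/mapP => [[ew cw sw]|[w' + ->]].
  case/lastP: w => // w c in ew cw sw *.
  rewrite size_rcons eqSS in sw.
  exists w.
    rewrite mem_catalan_words sw andbT.
    case: w cw {ew sw} => [|a s]; first by rewrite catalan_nil.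
    by rewrite catalan_rcons => /andP[].
  case: w cw ew {sw} => [|a s]; first by rewrite catalan_cons => /andP[/eqP->].
  rewrite catalan_rcons /extend rcons_cons /= final_flag_rcons => /andP[_ lec] ltc.
  by congr (_ :: rcons _ _); lia.
rewrite mem_catalan_words => /andP[cw /eqP <-]; rewrite size_rcons eqxx.
case: w' cw => [|a s]; first by rewrite /= catalan_cons.
move=> cw; rewrite /extend catalan_rcons cw leqnn.
by rewrite rcons_cons /= final_flag_rcons ltnn.
Qed.

(** * Recurrence for the coefficients *)

Local Notation coef_gf := (fps_coef (catalan_gf geq gtn)).

(** Words containing the pattern have weight 0, so all Catalan words may be summed over. *)
Lemma coef_gfE n : coef_gf n = \sum_(w <- catalan_words n) weight w.
Proof.
rewrite big_map big_filter /= big_mkcondr.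
by apply: eq_bigr.
Qed.

Lemma sum_ends_ascending n :
  \sum_(w <- catalan_words n.+1) (if ends_ascending w then weight w else 0)
  = coef_gf n.
Proof.
rewrite -big_mkcond -big_filter (perm_big _ (extend_words n)) big_map coef_gfE.
by apply: eq_bigr => w _; apply: weight_extend.
Qed.

Lemma coef_gf0 : coef_gf 0 = 1.
Proof. by rewrite coef_gfE catalan_words0 big_seq1 weight_nil. Qed.

Lemma coef_gfS n : coef_gf n.+1 =
  \sum_(k < n.+1) \sum_(u <- catalan_words k)
     \sum_(v <- catalan_words (n - k)) weight (graft u v).
Proof.
rewrite coef_gfE (perm_big _ (catalan_wordsS n)) big_allpairs_dep.
rewrite -[X in iota 0 X]subn0 -/(index_iota 0 n.+1) big_mkord.
by apply: eq_bigr => k _; rewrite big_allpairs.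
Qed.

Lemma sum_graft0 n :
  \sum_(u <- catalan_words 0) \sum_(v <- catalan_words n) weight (graft u v)
  = coef_gf n.
Proof.
rewrite catalan_words0 big_seq1 coef_gfE; apply: eq_big_seq => v.
by rewrite mem_catalan_words => /andP[cv _]; apply: weight_graft0.
Qed.

Lemma sum_graft_nil n :
  \sum_(u <- catalan_words n) \sum_(v <- catalan_words 0) weight (graft u v)
  = coef_gf n.
Proof.
rewrite catalan_words0 coef_gfE; apply: eq_big_seq => u.
by rewrite mem_catalan_words big_seq1 => /andP[cu _]; apply: weight_graft_nil.
Qed.

Lemma sum_graft j m :
  \sum_(u <- catalan_words j.+1) \sum_(v <- catalan_words m.+1)
     weight (graft u v) = 'X * (coef_gf j * coef_gf m.+1).
Proof.
rewrite -sum_ends_ascending coef_gfE big_distrl mulr_sumr.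
apply: eq_big_seq => u; rewrite mem_catalan_words => /andP[cu /eqP su].
rewrite big_distrr mulr_sumr.
apply: eq_big_seq => v; rewrite mem_catalan_words => /andP[cv /eqP sv].
by rewrite weight_graft ?su ?sv.
Qed.

Lemma coef_gf1 : coef_gf 1 = 1.
Proof. by rewrite coef_gfS big_ord1 sum_graft0 coef_gf0. Qed.

(** The two single terms come from empty [u] and empty [v]. These cases coincide at length 1, which
    is why the recurrence starts at length 2. *)
Lemma coef_gfSS n : coef_gf n.+2 =
  coef_gf n.+1 + coef_gf n.+1 + 'X * \sum_(j < n) coef_gf j * coef_gf (n - j).
Proof.
rewrite coef_gfS big_ord_recl subn0 sum_graft0 -addrA; congr (_ + _).
rewrite big_ord_recr /= subnn sum_graft_nil addrC; congr (_ + _).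
rewrite mulr_sumr; apply: eq_bigr => -[j ltjn] _ /=.
rewrite /bump /= !add1n subSS.
(* Here [j < n] ensures that [v] is nonempty. *)
by have [m ->] : exists m, (n - j = m.+1)%N; [exists (n - j).-1; lia|apply: sum_graft].
Qed.

(** * Functional equation and square root *)

Lemma fps_coefCM (R : comNzRingType) (c : R) f n :
  fps_coef (fpsC c * f) n = c * fps_coef f n.
Proof.
rewrite fps_coefM big_ord_recl /= subn0 big1 ?addr0 // => i _.
by rewrite mul0r.
Qed.

Lemma fps_coefXM0 (R : comNzRingType) (f : fps R) :
  fps_coef (fpsX R * f) 0 = 0.
Proof. by rewrite fps_coefM big_ord1 mul0r. Qed.

Lemma fps_coefXMS (R : comNzRingType) (f : fps R) n :
  fps_coef (fpsX R * f) n.+1 = fps_coef f n.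
Proof.
rewrite fps_coefM !big_ord_recl /= mul0r add0r mul1r subSS subn0.
by rewrite big1 ?addr0 // => i _; rewrite mul0r.
Qed.

(** The [- 1] corrects the double count of the one-letter word; [- F] removes from the convolution
    [F * F] its last term, where the second factor is [coef_gf 0 = 1]. *)
Lemma catalan_gf_eq (F := catalan_gf geq gtn) :
  F = 1 + fpsX _ * (F + F - 1 + fpsX _ * (fpsC 'X * (F * F - F))).
Proof.
rewrite /F; apply/fpsP => -[|[|n]].
- by rewrite fps_coefD fps_coefXM0 addr0 coef_gf0.
- rewrite fps_coefD fps_coefXMS !fps_coefD fps_coefXM0 fps_coefN !fps_coef1.
  by rewrite coef_gf1 !coef_gf0 /=; ring.
rewrite fps_coefD fps_coefXMS !fps_coefD fps_coefXMS fps_coefN !fps_coef1.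
rewrite fps_coefCM fps_coefD fps_coefN fps_coefM coef_gfSS.
move: coef_gf0; move: coef_gf => a a0.
by rewrite big_ord_recr /= subnn a0; ring.
Qed.

Theorem theorem3p16 :
  let x : fps {poly rat} := fpsX _ in
  let y : fps {poly rat} := fpsC 'X in
  2%:R * x ^+ 2 * y * catalan_gf geq gtn =
    1 - 2%:R * x + x ^+ 2 * y
    - fps_sqrt (1 - 4%:R * x + 4%:R * x ^+ 2 - 2%:R * x ^+ 2 * y
                + x ^+ 4 * y ^+ 2).
Proof.
move=> x y; set D := (X in fps_sqrt X).
have := catalan_gf_eq; rewrite -/x -/y; set F := catalan_gf _ _ => FE.
have coefx0 (f : fps {poly rat}) : fps_coef (1 + x * f) 0 = 1.
  by rewrite fps_coefD fps_coefXM0 addr0.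
have D0 : fps_coef D 0 = 1.
  rewrite (_ : D = 1 + x * (- 4%:R + 4%:R * x - 2%:R * x * y + x ^+ 3 * y ^+ 2)).
    exact: coefx0.
  by rewrite /D; ring.
(* This is the value the identity forces on the root, factored so that its constant term 1 is
   visible. *)
pose h := 1 + x * (- 2%:R + x * y - 2%:R * x * y * F).
have <- : h = fps_sqrt D.
  apply: (fps_sqrt_unique polyrat_unit2 D0); first exact: coefx0.
  have E0 : F - (1 + x * (F + F - 1 + x * (y * (F * F - F)))) = 0.
    by rewrite {1}FE subrr.
  (* Completing the square: [h ^+ 2] and [D] differ by a multiple of the defect of the functional
     equation, which [E0] makes vanish. *)
  have -> : h ^+ 2 = D - 4%:R * x ^+ 2 * y *
      (F - (1 + x * (F + F - 1 + x * (y * (F * F - F))))).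
    by rewrite /h /D; ring.
  by rewrite E0 mulr0 subr0.
by rewrite /h; ring.
Qed.
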